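(* Let $G$ be a finite simple graph and let $X$ be an independent set of $G$ with $d(X)=k>0$. If $d(Y)<k$ for every proper subset $Y \subsetneq X$, then $X$ can be expressed as a union of $k$ distinct inclusion minimal sets with positive difference.
   Context: For $A \subseteq V(G)$, $N(A)$ is the set of vertices adjacent to some vertex of $A$, and $d(A)=|A|-|N(A)|$. A set $S \subseteq V(G)$ is an inclusion minimal set with positive difference if $d(S)>0$ and no proper subset of $S$ has positive difference. *)

(* Defs.v *)
From mathcomp Require Import all_boot all_order all_algebra.

Set Implicit Arguments.
Unset Strict Implicit.
Unset Printing Implicit Defensive.

Import Order.TTheory GRing.Theory Num.Theory.

Local Open Scope ring_scope.

(* A finite simple graph is a symmetric irreflexive relation adj on a finType
   V; these two properties are hypotheses of the theorem. *)
Section GraphDifference.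
Variables (V : finType) (adj : rel V).
Implicit Types A S X : {set V}.

Definition independent X : Prop :=
  forall x y, x \in X -> y \in X -> ~~ adj x y.

(* N(A) may meet A when A is not independent. *)
Definition nbhd A : {set V} := [set v | [exists a in A, adj a v]].

(* Integer-valued: the difference can be negative. *)
Definition diff A : int := #|A|%:Z - #|nbhd A|%:Z.

Definition min_pos_diff S : bool := minset (fun A => 0 < diff A) S.

End GraphDifference.

(* Main.v *)
(** Supermodularity of the difference [d] drives an induction on [k].  Removing
    a vertex lowers [d] by at most one, so a minimal set [X] with [d X >= k+1]
    contains, avoiding any prescribed vertex, a minimal set with [d >= k].  Take
    such a [Y1], and such a [Y2] avoiding a vertex of [Y1].  Both are unions of
    [k] minimal positive sets, and some minimal positive [S] used in [Y2] is not
    contained in [Y1].  Then [d (S :&: Y1) <= 0], so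
    [d (S :|: Y1) >= d S + d Y1 >= k+1], whence [S :|: Y1 = X] by minimality,
    and [S] is the additional set. *)
Require Import Defs.
From mathcomp Require Import all_boot all_order all_algebra.
From mathcomp Require Import zify.

Set Implicit Arguments.
Unset Strict Implicit.
Unset Printing Implicit Defensive.

Import Order.TTheory GRing.Theory Num.Theory.

Local Open Scope ring_scope.

Section Difference.
Variables (V : finType) (adj : rel V).
Implicit Types (A B S X Y : {set V}) (x : V).

Local Notation N := (nbhd adj).
Local Notation d := (diff adj).

Lemma nbhdS A B : A \subset B -> N A \subset N B.
Proof.
move=> /subsetP sAB; apply/subsetP => v; rewrite !inE.
by case/exists_inP=> a /sAB aB av; apply/exists_inP; exists a.
Qed.

Lemma nbhdU A B : N (A :|: B) = N A :|: N B.
Proof.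
apply/eqP; rewrite eqEsubset subUset !nbhdS ?subsetUl ?subsetUr // !andbT.
apply/subsetP => v; rewrite !inE => /exists_inP [a].
by rewrite inE => /orP [aA|aB] av; apply/orP; [left|right];
  apply/exists_inP; exists a.
Qed.

Lemma diff0 : d set0 = 0.
Proof.
rewrite /diff; suff -> : N set0 = set0 by rewrite cards0.
by apply/setP => v; rewrite !inE; apply/exists_inP => -[a]; rewrite inE.
Qed.

(** Cardinality is modular and [N] commutes with unions, but [N (A :&: B)] is merely included in
    [N A :&: N B]; hence an inequality. *)
Lemma diff_supermodular A B : d A + d B <= d (A :|: B) + d (A :&: B).
Proof.
have cN : (#|N (A :&: B)| <= #|N A :&: N B|)%N.
  by apply: subset_leq_card; rewrite subsetI !nbhdS ?subsetIl ?subsetIr.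
have := cardsUI A B; have := cardsUI (N A) (N B).
rewrite /diff nbhdU; lia.
Qed.

(** Deleting [x] costs at most one element, while the neighbourhood can only shrink. *)
Lemma diffD1 X x : d X - 1 <= d (X :\ x).
Proof.
have := subset_leq_card (nbhdS (subD1set X x)).
have := cardsD1 x X; rewrite /diff; lia.
Qed.

Lemma minset_diff_pred (m : int) X x :
    minset (fun A => m + 1 <= d A) X -> x \in X ->
  exists2 Y, minset (fun A => m <= d A) Y & Y \subset X :\ x.
Proof.
move=> /minsetp dX xX.
have dXx : m <= d (X :\ x) by have := diffD1 X x; lia.
by have [Y] := @minset_exists _ (fun A => m <= d A) _ dXx; exists Y.
Qed.

Lemma diff_gt0_has_elt A : 0 < d A -> exists x, x \in A.
Proof. by move=> dA; apply/set0Pn; apply: contraTneq dA => ->; rewrite diff0. Qed.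

(** The threshold is a lower bound rather than an equality, so that the induction hypothesis applies
    to any minimal set extracted from [X] minus a vertex. *)
Lemma minset_diff_cover k X : minset (fun A => k.+1%:Z <= d A) X ->
  exists F : {set {set V}},
    [/\ #|F| = k.+1, (forall S, S \in F -> min_pos_diff adj S)
      & \bigcup_(S in F) S = X].
Proof.
elim: k X => [|k IHk] X minX.
  (* Over the integers [1 <= d A] is [0 < d A], so [X] alone is the family. *)
  by exists [set X]; split=> [|S /set1P->|]; rewrite ?cards1 ?big_set1.
have minX' : minset (fun A => k.+1%:Z + 1 <= d A) X.
  by rewrite -PoszD addn1.
have [x xX] : exists x, x \in X.
  by apply: diff_gt0_has_elt; have := minsetp minX; lia.
have [Y1 minY1 sY1] := minset_diff_pred minX' xX.
have [z zY1] : exists z, z \in Y1.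
  by apply: diff_gt0_has_elt; have := minsetp minY1; lia.
have sY1X := subset_trans sY1 (subD1set X x).
have [Y2 minY2 sY2] := minset_diff_pred minX' (subsetP sY1X z zY1).
have [F1 [cF1 minF1 defY1]] := IHk _ minY1.
have [F2 [_ minF2 defY2]] := IHk _ minY2.
(* Otherwise minimality of [Y1] gives [Y2 = Y1], which contains [z]. *)
have Y2nY1 : ~~ (Y2 \subset Y1).
  apply/negP => sY21; move: (subsetP sY2 z).
  by rewrite (minsetinf minY1 (minsetp minY2) sY21) !inE eqxx => /(_ zY1).
have [S SF2 SnY1] : exists2 S, S \in F2 & ~~ (S \subset Y1).
  apply/exists_inP; apply: contraR Y2nY1 => /exists_inPn sF2.
  by rewrite -defY2; apply/bigcupsP => S /sF2; rewrite negbK.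
have minS := minF2 S SF2.
have sSX : S \subset X.
  apply: subset_trans (subset_trans sY2 (subD1set X z)).
  by rewrite -defY2; apply: bigcup_sup.
have dSY1 : d (S :&: Y1) <= 0.
  rewrite leNgt; apply: contra SnY1 => dI.
  by apply/setIidPl/(minsetinf minS); rewrite ?subsetIl.
have defX : S :|: Y1 = X.
  apply: (minsetinf minX); last by rewrite subUset sSX.
  have := diff_supermodular S Y1; have := minsetp minS; have := minsetp minY1.
  by lia.
(* Members of [F1] lie inside [Y1], so [S] is new and the count rises by exactly one. *)
have SnF1 : S \notin F1.
  by apply: contra SnY1 => SF1; rewrite -defY1; apply: bigcup_sup.
exists (S |: F1); split; first by rewrite cardsU1 SnF1 cF1.
  by move=> T /setU1P [->|/minF1].
by rewrite big_setU1 // defY1.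
Qed.

End Difference.

Theorem theorem2p12 (V : finType) (adj : rel V)
    (adj_sym : symmetric adj) (adj_irr : irreflexive adj)
    (X : {set V}) (k : nat)
    (X_indep : independent adj X)
    (k_gt0 : (0 < k)%N) (dX : diff adj X = k%:Z)
    (dY : forall Y : {set V}, Y \proper X -> diff adj Y < k%:Z) :
  exists F : {set {set V}},
    [/\ #|F| = k,
        (forall S : {set V}, S \in F -> min_pos_diff adj S)
      & \bigcup_(S in F) S = X].
Proof.
case: k k_gt0 dX dY => // k _ dX dY; apply: minset_diff_cover.
apply/minsetP; split=> [|Y dYk sYX]; first by rewrite dX.
by apply/eqP; rewrite eqEproper sYX /=; apply: contraL dYk => /dY; rewrite ltNge.
Qed.
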